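(* Let $k\ge1$ be an integer and let $T^*_k(z)=\sum_{i\ge 0}|\mathcal{M}^*_{F_{k,i}}|\,z^i$ be the generating function of grand $k$-Fibonacci paths by length. Then, as formal power series, \[ T_k^*(z)=\frac{1-kz-z^2}{\sqrt{(1-(k+1)z-z^2)^2-4z^2(1-kz-z^2)^2}} =\cfrac{1}{1-\frac{z}{1-kz-z^2} - \cfrac{2z^2}{1-\frac{z}{1-kz-z^2}-\cfrac{z^2}{1-\frac{z}{1-kz-z^2}-\cfrac{z^2}{\ddots}}}}, \] and for every integer $t\ge1$, \[ [z^t]\,T_k^*(z)=F_{k+1,t}^{(1)} + \sum_{n=1}^{t}\sum_{m=0}^{t}\sum_{l=0}^{t-2n-2m}2^n\frac{n}{n+2m}\binom{n+2m}{m}\binom{l+2n+2m}{l}F_{k,t-2n-2m-l+1}^{(l)} . \]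
   Context: For a positive integer $k$, the $k$-Fibonacci numbers are defined by $F_{k,0}=0$, $F_{k,1}=1$, $F_{k,n+1}=kF_{k,n}+F_{k,n-1}$ for $n\ge1$. A grand $k$-Fibonacci path of length $n$ is a lattice path in $\mathbb{Z}\times\mathbb{Z}$ from $(0,0)$ to $(n,0)$ (with no restriction on going below the $x$-axis), built from rise steps $U=(1,1)$, fall steps $D=(1,-1)$, and horizontal steps $H_l=(l,0)$ for any positive integer $l$, where each step $H_l$ is additionally assigned one of $F_{k,l}$ colors (differently colored paths are counted as different). $\mathcal{M}^*_{F_{k,n}}$ denotes the set of such colored paths of length $n$; the empty path is the unique one of length $0$. The convolved $k$-Fibonacci numbers $F^{(r)}_{k,j}$ (for integers $r\ge0$, $j\ge1$, and any positive integer $k$) are defined by $(1-kx-x^2)^{-r}=\sum_{j\ge0}F^{(r)}_{k,j+1}x^j$ (so $F^{(0)}_{k,1}=1$, $F^{(0)}_{k,j}=0$ for $j\ge2$); sums whose upper limit is smaller than the lower limit are empty. The square root denotes the formal power series square root with constant term $1$, and the infinite continued fraction is the limit (in the formal power series topology) of its finite truncations. *)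

(* Defs.v *)
From HB Require Import structures.
From mathcomp Require Import all_boot all_order all_algebra.
From mathcomp Require Import boolp.

Set Implicit Arguments.
Unset Strict Implicit.
Unset Printing Implicit Defensive.

Import Order.TTheory GRing.Theory Num.Theory.
Local Open Scope ring_scope.

(* Course-of-values recursion: [cov F n] is [F] applied to the list of the
   values of [cov F] at 0, ..., n - 1. *)
Section CourseOfValues.
Variables (T : Type) (F : seq T -> T).

Fixpoint cov_seq n := if n is m.+1 then rcons (cov_seq m) (F (cov_seq m))
                      else [::].

Definition cov n := F (cov_seq n).

Lemma covE n : cov n = F (mkseq cov n).
Proof.
rewrite {1}/cov; congr F; elim: n => //= n IHn.
by rewrite mkseqS -IHn.
Qed.

End CourseOfValues.

Record fps (R : Type) := FPS { fcoef :> nat -> R }.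

HB.instance Definition _ (R : Type) := gen_eqMixin (fps R).
HB.instance Definition _ (R : Type) := gen_choiceMixin (fps R).

Lemma fpsP (R : Type) (f g : fps R) :
  (forall n, f n = g n) <-> f = g.
Proof.
case: f g => [f] [g]; split=> [/= fg|-> //].
by congr FPS; apply/funext.
Qed.

Section FpsZmod.
Variable R : zmodType.
Implicit Types f g h : fps R.

Definition fps_zero : fps R := FPS (fun n => 0).
Definition fps_opp f : fps R := FPS (fun n => - f n).
Definition fps_add f g : fps R := FPS (fun n => f n + g n).

Fact fps_addA : associative fps_add.
Proof. by move=> f g h; apply/fpsP=> n /=; rewrite addrA. Qed.
Fact fps_addC : commutative fps_add.
Proof. by move=> f g; apply/fpsP=> n /=; rewrite addrC. Qed.
Fact fps_add0 : left_id fps_zero fps_add.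
Proof. by move=> f; apply/fpsP=> n /=; rewrite add0r. Qed.
Fact fps_addN : left_inverse fps_zero fps_opp fps_add.
Proof. by move=> f; apply/fpsP=> n /=; rewrite addNr. Qed.

HB.instance Definition _ :=
  GRing.isZmodule.Build (fps R) fps_addA fps_addC fps_add0 fps_addN.

Lemma fcoef0 n : (0 : fps R) n = 0. Proof. by []. Qed.
Lemma fcoefD f g n : (f + g) n = f n + g n. Proof. by []. Qed.
Lemma fcoefN f n : (- f) n = - f n. Proof. by []. Qed.
Lemma fcoefB f g n : (f - g) n = f n - g n. Proof. by []. Qed.
Lemma fcoefMn f m n : (f *+ m) n = f n *+ m.
Proof. by elim: m => // m IHm; rewrite !mulrS fcoefD IHm. Qed.

End FpsZmod.

Section FpsRing.
Variable R : comNzRingType.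
Implicit Types f g h : fps R.

Definition fps_one : fps R := FPS (fun n => (n == 0%N)%:R).
Definition fps_mul f g : fps R :=
  FPS (fun n => \sum_(i < n.+1) f i * g (n - i)%N).

Definition fps_poly N f : {poly R} := \poly_(i < N) f i.

Lemma fps_mul_poly N f g n (p q : {poly R}) : (n < N)%N ->
    (forall i, (i < N)%N -> f i = p`_i) ->
    (forall i, (i < N)%N -> g i = q`_i) ->
  (fps_mul f g) n = (p * q)`_n.
Proof.
move=> ltnN fp gq; rewrite coefM /=; apply: eq_bigr => i _.
rewrite fp ?gq //; first exact: leq_ltn_trans (leq_subr _ _) ltnN.
exact: leq_ltn_trans (leq_ord i) ltnN.
Qed.

Lemma coef_fps_poly N f i : (i < N)%N -> f i = (fps_poly N f)`_i.
Proof. by rewrite coef_poly => ->. Qed.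

Fact fps_mulA : associative fps_mul.
Proof.
move=> f g h; apply/fpsP => n; pose P := fps_poly n.+1.
rewrite (@fps_mul_poly n.+1 _ _ _ (P f) (P g * P h)) //; last first.
- by move=> i ?; apply: (@fps_mul_poly n.+1) => // *; apply: coef_fps_poly.
- by move=> *; apply: coef_fps_poly.
rewrite mulrA; symmetry.
apply: (@fps_mul_poly n.+1) => // i ?; last exact: coef_fps_poly.
by apply: (@fps_mul_poly n.+1) => // *; apply: coef_fps_poly.
Qed.

Fact fps_mulC : commutative fps_mul.
Proof.
move=> f g; apply/fpsP => n; pose P := fps_poly n.+1.
rewrite (@fps_mul_poly n.+1 _ _ _ (P f) (P g)) // => [|*|*];
  try exact: coef_fps_poly.
rewrite mulrC; symmetry.
by apply: (@fps_mul_poly n.+1) => // *; apply: coef_fps_poly.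
Qed.

Fact fps_mul1 : left_id fps_one fps_mul.
Proof.
move=> f; apply/fpsP => n /=; rewrite big_ord_recl /= mul1r subn0.
by rewrite big1 ?addr0 // => i _; rewrite mul0r.
Qed.

Fact fps_mulDl : left_distributive fps_mul +%R.
Proof.
move=> f g h; apply/fpsP => n /=; rewrite -big_split /=.
by apply: eq_bigr => i _; rewrite mulrDl.
Qed.

Fact fps_oner_neq0 : fps_one != 0.
Proof. by apply/eqP => /fpsP/(_ 0%N)/eqP; rewrite /= oner_eq0. Qed.

HB.instance Definition _ := GRing.Zmodule_isComNzRing.Build (fps R)
  fps_mulA fps_mulC fps_mul1 fps_mulDl fps_oner_neq0.

Lemma fcoef1 n : (1 : fps R) n = (n == 0%N)%:R. Proof. by []. Qed.
Lemma fcoefM f g n :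
  (f * g) n = \sum_(i < n.+1) f i * g (n - i)%N.
Proof. by []. Qed.
Lemma fcoef0M f g : (f * g) 0 = f 0%N * g 0%N.
Proof. by rewrite fcoefM big_ord1. Qed.
Lemma fcoef_nat m n : (m%:R : fps R) n = (n == 0%N)%:R *+ m.
Proof. exact: fcoefMn. Qed.

Definition fpsX : fps R := FPS (fun n => (n == 1%N)%:R).

Lemma fcoefXM f n :
  (fpsX * f) n = if n is m.+1 then f m else 0.
Proof.
rewrite fcoefM; case: n => [|n]; first by rewrite big_ord1 mul0r.
rewrite !big_ord_recl /= mul0r add0r mul1r subSS subn0.
by rewrite big1 ?addr0 // => i _; rewrite mul0r.
Qed.

End FpsRing.

Section FpsUnitRing.
Variable R : comUnitRingType.
Implicit Types f g h : fps R.

Definition fps_unit : {pred fps R} :=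
  [pred f : fps R | f 0%N \is a GRing.unit].

(* The inverse of a series [f] with invertible constant term has coefficients
   g_0 = 1 / f_0 and g_n = - (1 / f_0) * \sum_(i < n) g_i f_(n-i). *)
Definition fps_inv_step f (s : seq R) : R :=
  (f 0%N)^-1 * ((size s == 0%N)%:R
                - \sum_(i < size s) s`_i * f (size s - i)%N).

Definition fps_inv f : fps R :=
  if f \in fps_unit then FPS (cov (fps_inv_step f)) else f.

Fact fps_mulVx : {in fps_unit, left_inverse 1 fps_inv *%R}.
Proof.
move=> f f_unit; apply/fpsP => n; rewrite /fps_inv f_unit fcoefM /=.
rewrite big_ord_recr /= subnn covE /fps_inv_step size_mkseq.
rewrite mulrC mulVKr // addrC -[RHS]addr0 -addrA; congr (_ + _).
apply/eqP; rewrite addrC subr_eq0; apply/eqP.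
by apply: eq_bigr => i _; rewrite nth_mkseq.
Qed.

Fact fps_unitPl f g : g * f = 1 -> fps_unit f.
Proof.
move=> /fpsP/(_ 0%N); rewrite fcoef0M fcoef1 /= mulrC => fg1.
by apply/unitrPr; exists (g 0%N).
Qed.

Fact fps_inv_out : {in [predC fps_unit], fps_inv =1 id}.
Proof. by move=> f; rewrite inE /fps_inv => /negbTE->. Qed.

HB.instance Definition _ := GRing.ComNzRing_hasMulInverse.Build (fps R)
  fps_mulVx fps_unitPl fps_inv_out.

Lemma fps_unitE f : (f \is a GRing.unit) = (f 0%N \is a GRing.unit).
Proof. by []. Qed.

(* For [f] with constant term 1 (and 2 invertible in [R]), [fps_sqrt f] is the
   square root of [f] with constant term 1, see [fps_sqrtP]; its coefficients
   are g_0 = 1 and g_n = (f_n - \sum_(0 < i < n) g_i g_(n-i)) / 2. *)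
Definition fps_sqrt_step f (s : seq R) : R :=
  if s is [::] then 1
  else (f (size s) - \sum_(1 <= i < size s) s`_i * s`_(size s - i)) / 2%:R.

Definition fps_sqrt f : fps R := FPS (cov (fps_sqrt_step f)).

Lemma fps_sqr_recr f n :
  (f ^+ 2) n.+1 =
    f 0%N * f n.+1 *+ 2
    + \sum_(1 <= i < n.+1) f i * f (n.+1 - i)%N.
Proof.
rewrite expr2 fcoefM -(big_mkord xpredT (fun i => f i * f (n.+1 - i)%N)).
rewrite big_nat_recl // big_nat_recr //= subn0 subnn [f n.+1 * _]mulrC.
by rewrite [in RHS]big_add1 /= mulr2n -[RHS]addrA [_ + \sum_(_ <= _ < _) _]addrC.
Qed.

Lemma fps_sqrtP f : 2%:R \is a @GRing.unit R -> f 0%N = 1 ->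
  fps_sqrt f ^+ 2 = f /\ fps_sqrt f 0 = 1.
Proof.
move=> u2 f0; split=> //; apply/fpsP => -[|n].
  by rewrite expr2 fcoef0M f0 /= mulr1.
rewrite fps_sqr_recr [fps_sqrt f 0]/= mul1r.
rewrite [fps_sqrt f n.+1]/= covE.
have -> s : size s = n.+1 -> fps_sqrt_step f s =
    (f n.+1 - \sum_(1 <= i < n.+1) s`_i * s`_(n.+1 - i)) / 2%:R.
  by case: s => //= a s ->.
rewrite -mulr_natr divrK // -[RHS]addr0 -addrA; congr (_ + _).
  apply/eqP; rewrite addrC subr_eq0; apply/eqP.
  apply: eq_big_nat => i /andP[i0 ltin].
  by rewrite !nth_mkseq // ltn_subrL i0.
by rewrite size_mkseq.
Qed.

Lemma fps_sqrt_uniq f g : 2%:R \is a @GRing.unit R ->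
  g ^+ 2 = f -> g 0%N = 1 -> g = fps_sqrt f.
Proof.
move=> u2 g2 g0; have f0 : f 0%N = 1 by rewrite -g2 expr2 fcoef0M g0 mulr1.
have [h2 h0] := fps_sqrtP u2 f0; move: (fps_sqrt f) h2 h0 => h h2 h0.
have gh0 : (g - h) * (g + h) = 0 by rewrite -subr_sqr g2 h2 subrr.
have uD : g + h \is a GRing.unit by rewrite fps_unitE fcoefD g0 h0.
by apply/eqP; rewrite -subr_eq0 -(mulrK uD (g - h)) gh0 mul0r.
Qed.

End FpsUnitRing.

(* Convergence for the formal power series topology: the n-th coefficient
   of [u i] is eventually equal to that of [f], for every n. *)
Definition fps_cvg (R : Type) (u : nat -> fps R) (f : fps R) : Prop :=
  forall n, exists N, forall i, (N <= i)%N -> (u i) n = f n.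

(* [cfrac a b N j] is the finite continued fraction
   a_j / (b_j - a_(j+1) / (b_(j+1) - ... - a_(j+N) / b_(j+N))). *)
Fixpoint cfrac (F : unitRingType) (a b : nat -> F) (N j : nat) : F :=
  if N is M.+1 then a j / (b j - cfrac a b M j.+1) else a j / b j.

Fixpoint kfib (k n : nat) : nat :=
  match n with
  | 0 => 0
  | 1 => 1
  | (m.+1 as m').+1 => (k * kfib k m' + kfib k m)%N
  end.
Arguments kfib : simpl never.

(* [Horiz l c] is the horizontal step of length l + 1 with colour [c], so that
   horizontal steps have positive length. *)
Inductive step (k : nat) : Type :=
  | Rise
  | Fall
  | Horiz (l : nat) of 'I_(kfib k l.+1).
Arguments Rise {k}.
Arguments Fall {k}.

Section Steps.
Variable k : nat.

Definition step_code (s : step k) : bool + {l : nat & 'I_(kfib k l.+1)} :=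
  match s with
  | Rise => inl true
  | Fall => inl false
  | Horiz l c => inr (Tagged (fun l => 'I_(kfib k l.+1)) c)
  end.

Definition step_decode (x : bool + {l : nat & 'I_(kfib k l.+1)}) : step k :=
  match x with
  | inl b => if b then Rise else Fall
  | inr u => Horiz (tagged u)
  end.

Fact step_codeK : cancel step_code step_decode. Proof. by case. Qed.

HB.instance Definition _ := Countable.copy (step k) (can_type step_codeK).

Definition displacement (s : step k) : int * int :=
  match s with
  | Rise => (1, 1)
  | Fall => (1, -1)
  | Horiz l _ => (l.+1%:Z, 0)
  end.

Definition endpoint (p : seq (step k)) : int * int :=
  \sum_(s <- p) displacement s.

End Steps.

Record grand_path (k n : nat) := GrandPath {
  steps_of :> seq (step k);
  _ : endpoint steps_of == (n%:Z, 0)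
}.

HB.instance Definition _ k n := [isSub for @steps_of k n].
HB.instance Definition _ k n := [Countable of grand_path k n by <:].

(* A path of length n has at most n steps, each of length at most n: this
   gives the finType structure on [grand_path k n]. *)
Section GrandPathFinite.
Variables k n : nat.

Definition small_steps : seq (step k) :=
  [:: Rise; Fall] ++ [seq Horiz c | l <- iota 0 n, c <- enum 'I_(kfib k l.+1)].

Fixpoint words (T : Type) (a : seq T) (m : nat) : seq (seq T) :=
  if m is m'.+1 then [::] :: [seq x :: w | x <- a, w <- words a m']
  else [:: [::]].

Lemma mem_words (T : eqType) (a w : seq T) m :
  (size w <= m)%N -> all (mem a) w -> w \in words a m.
Proof.
elim: m w => [|m IHm] [|x w] //= szw /andP[ax aw]; rewrite inE /=.
by apply/allpairsP; exists (x, w); split=> //; apply: IHm.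
Qed.

Lemma endpoint_cons (s : step k) p :
  endpoint (s :: p) = displacement s + endpoint p.
Proof. exact: big_cons. Qed.

Definition width (s : step k) : nat := if s is Horiz l _ then l.+1 else 1.

Lemma endpoint1 (p : seq (step k)) :
  (endpoint p).1 = (\sum_(s <- p) width s)%N%:Z.
Proof.
elim: p => [|s p IHp]; first by rewrite /endpoint !big_nil.
by rewrite endpoint_cons big_cons PoszD -IHp; case: s.
Qed.

Lemma grand_path_words (p : grand_path k n) :
  (p : seq (step k)) \in words small_steps n.
Proof.
case: p => p /= /eqP ep; have := endpoint1 p; rewrite ep => -[->].
apply: mem_words.
  by elim: p {ep} => // s p IHp; rewrite big_cons /= -add1n leq_add //; case: s.
apply/allP => s sp /=; case: s sp => [||l c] sp; rewrite !inE //=.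
apply/allpairsPdep; exists l, c; split=> //.
  rewrite mem_iota /= add0n; have := endpoint1 p; rewrite ep => -[->].
  by rewrite (big_rem _ sp) /= leq_addr.
by rewrite mem_enum.
Qed.

Definition grand_path_enum : seq (grand_path k n) :=
  undup (pmap insub (words small_steps n)).

Fact grand_path_enumP : Finite.axiom grand_path_enum.
Proof.
apply: Finite.uniq_enumP; first exact: undup_uniq.
by move=> p; rewrite mem_undup mem_pmap_sub grand_path_words.
Qed.

HB.instance Definition _ := isFinite.Build (grand_path k n) grand_path_enumP.

End GrandPathFinite.

(* Generating functions are taken with rational coefficients, which makes room
   for the square root and for the fraction n / (n + 2 m). *)

Definition grand_gf (k : nat) : fps rat :=
  FPS (fun i => #|{: grand_path k i}|%:R).

(* 1 - k z - z^2 *)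
Definition kfib_den (k : nat) : fps rat :=
  1 - k%:R * fpsX rat - fpsX rat ^+ 2.

(* The convolved k-Fibonacci number F^(r)_(k,j), for j >= 1. *)
Definition conv_kfib (k r j : nat) : rat := (kfib_den k ^- r) (j.-1).

(* Main.v *)
Require Import Defs.
From mathcomp Require Import all_boot all_order all_algebra.
From mathcomp Require Import zify ring.

(** Let w = 1 - k z - z^2 and b = 1 - z / w, where z / w counts one coloured
    horizontal step, and let q be the series without constant term such that
    b q = z (1 + q^2).  Splitting off the first step, the generating function
    A_h of the paths ending at height h is determined by
    b A_h = [h = 0] + z (A_(h-1) + A_(h+1)), which is solved by
    A_h = q^|h| / (b - 2 z q); hence T = 1 / (b - 2 z q).
    Since (b - 2 z q)^2 = b^2 - 4 z^2, this is the closed form.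
    Since y = z q satisfies y = z^2 / (b - y), each level of the continued
    fraction gains a power of z in the approximation of y by its tails.
    Finally g = y / b satisfies g = z^2 / b^2 + g^2, so the powers of g expand
    in z^2 / b^2 with ballot numbers as coefficients, and expanding
    T = b^-1 / (1 - 2 g) in powers of g, then of z^2 / b^2, then of z / w gives
    the triple sum. *)

Set Implicit Arguments.
Unset Strict Implicit.
Import Order.TTheory GRing.Theory Num.Theory.
Local Open Scope ring_scope.

(** * Congruences modulo powers of [z], and expansions of powers of series *)

Section DvdX.
Variable R : comUnitRingType.
Implicit Types f g u x : fps R.
Local Notation z := (fpsX R).

Definition dvdX n f := exists g, f = z ^+ n * g.

Lemma fcoefXnM n f i :
  (z ^+ n * f) i = if (n <= i)%N then f (i - n)%N else 0.
Proof.
elim: n i => [|n IHn] [|i]; rewrite ?expr0 ?mul1r ?subn0 //.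
  by rewrite exprS -mulrA fcoefXM.
by rewrite exprS -mulrA fcoefXM IHn ltnS subSS.
Qed.

Lemma fcoef_natM n f i : (n%:R * f) i = n%:R * f i.
Proof. by rewrite !mulr_natl fcoefMn. Qed.

Lemma fcoef_sum (I : Type) (r : seq I) (P : pred I) (F : I -> fps R) i :
  (\sum_(j <- r | P j) F j) i = \sum_(j <- r | P j) F j i.
Proof. by elim/big_rec2: _ => // j a f _ <-. Qed.

Lemma dvdX_coef n f i : dvdX n f -> (i < n)%N -> f i = 0.
Proof. by case=> g -> ltin; rewrite fcoefXnM leqNgt ltin. Qed.

Lemma dvdX_eq_coef n f g i : dvdX n (f - g) -> (i < n)%N -> f i = g i.
Proof. by move=> fg /(dvdX_coef fg) /eqP; rewrite fcoefB subr_eq0 => /eqP. Qed.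

Lemma dvdX1 f : f 0%N = 0 -> dvdX 1 f.
Proof.
move=> f0; exists (FPS (fun i => f i.+1)); apply/fpsP => -[|i].
  by rewrite fcoefXnM.
by rewrite fcoefXnM /= subn1.
Qed.

Lemma dvdX0 f : dvdX 0 f.
Proof. by exists f; rewrite mul1r. Qed.

Lemma dvdX_zero n : dvdX n 0.
Proof. by exists 0; rewrite mulr0. Qed.

Lemma dvdXD n f g : dvdX n f -> dvdX n g -> dvdX n (f + g).
Proof. by case=> f' -> [g' ->]; exists (f' + g'); rewrite mulrDr. Qed.

Lemma dvdXM m n f g : dvdX m f -> dvdX n g -> dvdX (m + n) (f * g).
Proof. by case=> f' -> [g' ->]; exists (f' * g'); rewrite exprD mulrACA. Qed.

Lemma dvdXMl n f g : dvdX n g -> dvdX n (f * g).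
Proof. exact: (dvdXM (dvdX0 f)). Qed.

Lemma dvdXX m n f : dvdX m f -> dvdX (m * n) (f ^+ n).
Proof.
move=> mf; elim: n => [|n IHn]; first by rewrite muln0; apply: dvdX0.
by rewrite mulnS exprS; apply: dvdXM.
Qed.

(** Double induction on [L] and [r]: Pascal's rule matches [(1 - u)^-(r+1) = u (1 - u)^-(r+1) + (1 -
    u)^-r]. *)
Lemma neg_binomial_expansion u r L : dvdX 1 u ->
  dvdX L ((1 - u) ^- r - \sum_(l < L) ('C(l + r - 1, l))%:R * u ^+ l).
Proof.
move=> u1; have unitu : 1 - u \is a GRing.unit.
  by rewrite fps_unitE fcoefB (dvdX_coef u1) // subr0 unitr1.
elim: L r => [|L IHL]; first by move=> r; apply: dvdX0.
elim=> [|r IHr].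
  (* For [r = 0] the truncated [l - 1] leaves only the term [l = 0]. *)
  rewrite big_ord_recl !expr0 invr1 bin0 mulr1 opprD addNKr big1 ?oppr0.
    exact: dvdX_zero.
  by move=> i _; rewrite /bump /= ?add1n addn0 subn1 bin_small // mul0r.
have step : (1 - u) ^- r.+1 = u * (1 - u) ^- r.+1 + (1 - u) ^- r.
  rewrite -!exprVn exprS; have := mulVr unitu.
  move: (_^-1) => V Vu; rewrite -[X in _ + X]mul1r -[X in _ + X * _]Vu.
  by ring.
have -> : (1 - u) ^- r.+1
      - \sum_(l < L.+1) ('C(l + r.+1 - 1, l))%:R * u ^+ l =
    u * ((1 - u) ^- r.+1 - \sum_(l < L) ('C(l + r.+1 - 1, l))%:R * u ^+ l)
    + ((1 - u) ^- r - \sum_(l < L.+1) ('C(l + r - 1, l))%:R * u ^+ l).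
  rewrite {1}step mulrBr -!addrA; congr (_ + _).
  rewrite [RHS]addrCA; congr (_ + _).
  rewrite -opprD; congr (- _).
  rewrite !big_ord_recl !bin0 /= addrCA mulr_sumr -big_split /=; congr (_ + _).
  apply: eq_bigr => i _; rewrite /bump /= ?add1n !addSn !addnS !subn1 /=.
  by rewrite binS natrD exprS; ring.
by apply: dvdXD; [rewrite -add1n; apply: dvdXM | apply: IHr].
Qed.

(* [ballot m n] is [n / (n + 2 m) 'C(n + 2 m, m)], with value 1 at
   [n = m = 0]. *)
Fixpoint ballot m : nat -> nat :=
  if m is m'.+1 then
    fix ballot_m n := if n is n'.+1 then (ballot_m n' + ballot m' n.+1)%N else 0
  else fun _ => 1%N.

Lemma ballotSS m n : ballot m.+1 n.+1 = (ballot m.+1 n + ballot m n.+2)%N.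
Proof. by []. Qed.

Lemma ballotE m n : (ballot m n * (n + 2 * m) = n * 'C(n + 2 * m, m))%N.
Proof.
elim: m n => [|m IHm] n; first by rewrite muln0 addn0 bin0 /= mulnC.
elim: n => [|n IHn] //.
have {}IHm := IHm n.+2; rewrite ballotSS.
move: (ballot _ _) (ballot _ _) IHn IHm => d c.
have -> : (n + 2 * m.+1 = (n + 2 * m).+2)%N by lia.
have -> : (n.+2 + 2 * m = (n + 2 * m).+2)%N by lia.
have -> : (n.+1 + 2 * m.+1 = (n + 2 * m).+3)%N by lia.
have := mul_bin_left (n + 2 * m).+2 m.
have -> : ((n + 2 * m).+2 - m = n + m + 2)%N by lia.
rewrite [in 'C(_.+3, _)]binS.
move: 'C(_, _) 'C(_, _) => A B AB Hc Hd.
(* This factor occurs in both induction hypotheses, which can then be substituted. *)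
apply/eqP; rewrite -(@eqn_pmul2l (n + 2 * m).+2) //; apply/eqP.
have -> : ((n + 2 * m).+2 * ((c + d) * (n + 2 * m).+3) =
   (c * (n + 2 * m).+2 + d * (n + 2 * m).+2) * (n + 2 * m).+3)%N by ring.
rewrite Hc Hd; nia.
Qed.

(* The ballot recursion mirrors [g^(n+1) = x g^n + g^(n+2)]. *)
Lemma ballot_expansion x g m n : dvdX 2 x -> dvdX 2 g -> g = x + g ^+ 2 ->
  dvdX (2 * (n + m)) (g ^+ n - \sum_(i < m) (ballot i n)%:R * x ^+ (n + i)).
Proof.
move=> x2 g2 gE; elim: m n => [|m IHm] n.
  by rewrite big_ord0 subr0 addn0; apply: dvdXX.
elim: n => [|n IHn].
  rewrite big_ord_recl /= !expr0 mulr1 opprD addNKr big1 ?oppr0.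
    exact: dvdX_zero.
  by move=> i _; rewrite mul0r.
have step : g ^+ n.+1 = x * g ^+ n + g ^+ n.+2.
  by rewrite exprS {1}gE mulrDl -exprD.
have -> : g ^+ n.+1 - \sum_(i < m.+1) (ballot i n.+1)%:R * x ^+ (n.+1 + i) =
  x * (g ^+ n - \sum_(i < m.+1) (ballot i n)%:R * x ^+ (n + i))
  + (g ^+ n.+2 - \sum_(i < m) (ballot i n.+2)%:R * x ^+ (n.+2 + i)).
  rewrite {1}step mulrBr -!addrA; congr (_ + _).
  rewrite [RHS]addrCA; congr (_ + _).
  rewrite -opprD; congr (- _).
  rewrite !big_ord_recl /= !addn0 !mul1r mulrDr -exprS -addrA; congr (_ + _).
  rewrite mulr_sumr -big_split /=; apply: eq_bigr => i _.
  by rewrite /bump /= ?add1n natrD !addSn !addnS !exprS; ring.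
(* One term fewer suffices for [g ^+ n.+2], as [n.+2 + m = n.+1 + m.+1]. *)
apply: dvdXD; last by have := IHm n.+2; rewrite addSnnS addSn -addnS.
by rewrite addSn mulnS; apply: dvdXM.
Qed.

(** The difference of the inverses is [- (f^-1 * g^-1) * (f - g)]. *)
Lemma invrB_dvdX n f g : f \is a GRing.unit -> g \is a GRing.unit ->
  dvdX n (f - g) -> dvdX n (f^-1 - g^-1).
Proof.
move=> uf ug /(dvdXMl (- (f^-1 * g^-1))).
have ff := mulVr uf; have gg := mulVr ug.
set F := f^-1 in ff *; set G := g^-1 in gg *.
suff -> : - (F * G) * (f - g) = F - G by [].
by transitivity (F * (G * g) - G * (F * f)); [ring | rewrite ff gg !mulr1].
Qed.

End DvdX.

(** * Enumeration of paths by their first step *)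

Section Paths.
Variable k : nat.

Lemma small_steps_uniq n : uniq (small_steps k n).
Proof.
rewrite cat_uniq; apply/and3P; split=> //.
  by apply/hasPn => s /allpairsPdep[l [c [_ _ ->]]].
apply: allpairs_uniq_dep; [exact: iota_uniq | by move=> *; apply: enum_uniq |].
move=> [l c] [l' c'] _ _ /= eq_step.
(* Reading a step back as a dependent pair recovers length and colour together; the default serves
   the other steps. *)
by apply: (congr1 (fun s => if s is Horiz l c then Tagged _ c
  else existT (fun l => 'I_(kfib k l.+1)) l c) eq_step).
Qed.

(** The bound is a successor because [Rise] and [Fall], of width 1, are always listed. *)
Lemma mem_small_steps n (s : step k) :
  (s \in small_steps k n.+1) = (width s <= n.+1)%N.
Proof.
case: s => [||l c]; rewrite mem_cat ?mem_head //.
have -> : (Horiz c \in [:: Rise; Fall]) = false by []; rewrite orFb.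
rewrite [width _]/=.
apply/allpairsPdep/idP => [[l' [c' [+ _ /(congr1 (@width k)) [->]]]]|ltln].
  by rewrite mem_iota.
by exists l, c; rewrite mem_iota mem_enum.
Qed.

(* [f] is fuel: the enumeration is complete as soon as [n <= f]. *)
Fixpoint paths f n (h : int) : seq (seq (step k)) :=
  match n, f with
  | 0, _ => if h == 0 then [:: [::]] else [::]
  | _, 0 => [::]
  | _, f'.+1 => [seq s :: p | s <- small_steps k n,
                   p <- paths f' (n - width s)%N (h - (displacement s).2)]
  end.

Lemma pathsSS f n h :
  paths f.+1 n.+1 h = [seq s :: p | s <- small_steps k n.+1,
                         p <- paths f (n.+1 - width s)%N (h - (displacement s).2)].
Proof. by []. Qed.

Lemma mem_paths f n h p : (n <= f)%N ->
  (p \in paths f n h) = (endpoint p == (n%:Z, h)).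
Proof.
elim: f n h p => [|f IHf] [|n] h p //.
1,2: move=> _; case: p => [|s p] /=;
  first by rewrite /endpoint big_nil xpair_eqE /= eq_sym; case: eqP.
1,2: apply/idP/idP; first by case: ifP.
1,2: by move=> /eqP/(congr1 fst) /=; rewrite endpoint1 big_cons; case: s.
rewrite ltnS => lenf.
(* Every step has positive width, so one unit of fuel pays for it. *)
have lenw s : (n.+1 - width s <= f)%N by case: (s) => *; rewrite /= leq_subLR; lia.
apply/allpairsPdep/idP => [[s [p' [sw pp ->]]]|].
  move: pp sw; rewrite mem_small_steps IHf // endpoint_cons => /eqP -> sw.
  rewrite xpair_eqE /= -subzn //; apply/andP; split; last first.
    by rewrite addrC subrK.
  by rewrite addrC; case: s sw => [||l c] /= _; rewrite subrK.
case: p => [|s p]; first by rewrite /endpoint big_nil.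
move=> ep; have ws : (width s <= n.+1)%N.
  have := endpoint1 (s :: p); rewrite (eqP ep) big_cons => -[->].
  exact: leq_addr.
exists s, p; split=> //; first by rewrite mem_small_steps.
rewrite IHf // -subzn //; move: ep; rewrite endpoint_cons.
case: (endpoint p) => a b; rewrite !xpair_eqE /= => /andP[/eqP <- /eqP <-].
by rewrite ![_ + _ - _]addrAC; case: s {ws} => *; rewrite /= !subrr !add0r !eqxx.
Qed.

Lemma paths_uniq f n h : uniq (paths f n h).
Proof.
elim: f n h => [|f IHf] [|n] h; rewrite //; try by rewrite /=; case: ifP.
rewrite pathsSS allpairs_uniq_dep ?small_steps_uniq //.
by move=> [s p] [s' p'] _ _ /= [-> ->].
Qed.

Lemma card_grand_path n : #|{: grand_path k n}| = size (paths n n 0).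
Proof.
rewrite cardT -(size_map val); apply: perm_size; apply: uniq_perm.
- by rewrite map_inj_uniq ?enum_uniq //; apply: val_inj.
- exact: paths_uniq.
move=> p; rewrite mem_paths //; apply/mapP/idP => [[[q Hq] _ ->] //|Hp].
by exists (GrandPath Hp); rewrite ?mem_enum.
Qed.

Lemma size_paths_rec f n h :
  size (paths f.+1 n.+1 h) =
    (size (paths f n (h - 1)) + size (paths f n (h + 1))
     + \sum_(l < n.+1) kfib k l.+1 * size (paths f (n - l) h))%N.
Proof.
rewrite pathsSS size_allpairs_dep sumnE big_map.
rewrite big_cat !big_cons big_nil big_allpairs_dep /= !subSS subn0 opprK.
rewrite addn0 subr0; congr addn.
rewrite -(big_mkord xpredT (fun l => kfib k l.+1 * size (paths f (n - l) h))%N).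
rewrite /index_iota subn0; apply: eq_bigr => l _; rewrite big_enum /=
  sum_nat_const card_ord.
by rewrite subSS.
Qed.

End Paths.

(** * The root of the kernel equation *)

Section Kernel.
Local Notation z := (fpsX rat).
Implicit Types b q : fps rat.

Lemma rat2_unit : (2%:R : rat) \is a GRing.unit.
Proof. by rewrite unitfE pnatr_eq0. Qed.

(** Cancelling [z], and below positive integers, justifies the division by [2 z] in the quadratic
    formula. *)
Lemma fpsX_inj : injective ( *%R z).
Proof. by move=> f g /fpsP fg; apply/fpsP => n; have := fg n.+1; rewrite !fcoefXM. Qed.

Lemma fps_natM_inj n : (0 < n)%N -> injective ( *%R (n%:R : fps rat)).
Proof.
move=> n0 f g /fpsP fg; apply/fpsP => i; have := fg i; rewrite !fcoef_natM.
by apply: mulfI; rewrite pnatr_eq0 -lt0n.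
Qed.

(** Take [q = (b - s) / (2 z)] with [s] the root of [b^2 - 4 z^2]; [z] divides [b - s] since both
    have constant term 1. *)
Lemma kernel_root b : b 0%N = 1 ->
  exists q, q 0%N = 0 /\ b * q = z * (1 + q ^+ 2).
Proof.
move=> b0; set f := b ^+ 2 - 4%:R * z ^+ 2.
have f0 : f 0%N = 1.
  by rewrite fcoefB fcoef_natM -[z ^+ 2]mulr1 fcoefXnM mulr0 subr0 expr2
    fcoef0M b0 mulr1.
have [] := fps_sqrtP rat2_unit f0; move: (fps_sqrt f) => s s2 s0.
have [|h bsE] := @dvdX1 _ (b - s); first by rewrite fcoefB b0 s0 subrr.
have [q qE] : exists q, h = 2%:R * q.
  exists (FPS (fun i => h i / 2%:R)); apply/fpsP => i.
  by rewrite fcoef_natM /= mulrC divfK.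
have sE : s = b - z * (2%:R * q) by rewrite -qE -[z]expr1 -bsE opprB addrC subrK.
have bq : b * q = z * (1 + q ^+ 2).
  (* With [s = b - 2 z q], [s ^+ 2 - f] is [- 4 z] times the difference of the two sides. *)
  apply: fpsX_inj; apply: (@fps_natM_inj 4) => //.
  have e : s ^+ 2 - f = 0 by rewrite s2 subrr.
  apply/eqP; rewrite -subr_eq0 -oppr_eq0 -[X in _ == X]e sE /f; apply/eqP.
  by ring.
exists q; split=> //; have /fpsP/(_ 0%N) := bq.
by rewrite fcoef0M fcoefXM b0 mul1r.
Qed.

End Kernel.

(** * The series [w] and [b], and the inverse powers of [b] *)

Section Main.
Variable k : nat.
Local Notation z := (fpsX rat).
Local Notation w := (kfib_den k).

Lemma kfib_den0 : w 0%N = 1.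
Proof.
by rewrite !fcoefB mulrC fcoefXM expr2 fcoefXM !subr0.
Qed.

Lemma kfib_den_unit : w \is a GRing.unit.
Proof. by rewrite fps_unitE kfib_den0. Qed.

Lemma kfib_gf : z / w = FPS (fun n => (kfib k n)%:R).
Proof.
set K := FPS _; suff -> : z = w * K by rewrite mulrC mulKr ?kfib_den_unit.
apply/fpsP => n; rewrite !mulrBl mul1r -mulrA !fcoefB fcoef_natM expr2 -mulrA.
rewrite !fcoefXM; case: n => [|n]; first by rewrite mulr0 !subr0.
rewrite fcoefXM; case: n => [|n]; first by rewrite /= mulr0 !subr0.
have -> : K n.+2 = (k * kfib k n.+1 + kfib k n)%:R by [].
by rewrite natrD natrM [_ * _ + _]addrC addrK subrr.
Qed.

Definition level_den : fps rat := 1 - z / w.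
Local Notation b := level_den.

Lemma level_den0 : b 0%N = 1.
Proof. by rewrite fcoefB kfib_gf subr0. Qed.

Lemma level_den_unit : b \is a GRing.unit.
Proof. by rewrite fps_unitE level_den0. Qed.

(** Since [w b = w - z], the parameter rises to [k + 1]. *)
Lemma kfib_den_level_den : w * b = kfib_den k.+1.
Proof.
rewrite mulrBr mulr1 mulrCA divrr ?mulr1 ?kfib_den_unit // /kfib_den -(natr1 k).
by ring.
Qed.

Lemma level_den_pow_coef r j :
  (b ^- r) j = \sum_(l < j.+1) ('C(l + r - 1, l))%:R * (w ^- l) (j - l)%N.
Proof.
have u1 : dvdX 1 (z / w) by apply: dvdX1; rewrite fcoefXM.
rewrite (dvdX_eq_coef (neg_binomial_expansion r j.+1 u1)) // fcoef_sum.
apply: eq_bigr => l _; rewrite fcoef_natM exprMn exprVn fcoefXnM.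
by rewrite -ltnS ltn_ord.
Qed.

(** Here [b^-1 = w / (w - z) = 1 + z / (w - z)], and the 1 is invisible in positive degree. *)
Lemma level_den_inv_coef t : b^-1 t.+1 = (kfib_den k.+1)^-1 t.
Proof.
have wb := kfib_den_level_den.
have d1 : kfib_den k.+1 \is a GRing.unit.
  by rewrite -wb unitrM kfib_den_unit level_den_unit.
suff -> : b^-1 = 1 + z * (kfib_den k.+1)^-1.
  by rewrite fcoefD fcoefXM fcoef1 add0r.
apply: (mulrI d1); rewrite mulrDr mulr1 mulrCA divrr // mulr1 -{1}wb.
by rewrite mulrK ?level_den_unit // /kfib_den -(natr1 k); ring.
Qed.

(** * Generating functions by final height, and the closed form *)

Variable q : fps rat.
Hypothesis q0 : q 0%N = 0.
Hypothesis bq : b * q = z * (1 + q ^+ 2).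

Lemma height_den0 : (b - 2%:R * (z * q)) 0%N = 1.
Proof. by rewrite fcoefB level_den0 fcoef_natM fcoefXM mulr0 subr0. Qed.

Lemma height_den_unit : b - 2%:R * (z * q) \is a GRing.unit.
Proof. by rewrite fps_unitE height_den0. Qed.

Definition height_gf (h : int) : fps rat := (b - 2%:R * (z * q))^-1 * q ^+ `|h|%N.

(** For [h != 0] this is [bq] times a power of [q]; at [h = 0] both neighbours contribute [q], and
    the factor [(b - 2 z q)^-1] yields the 1. *)
Lemma height_gfE h : height_gf h =
  (h == 0)%:R + z * (height_gf (h - 1) + height_gf (h + 1))
  + z / w * height_gf h.
Proof.
have VE := mulVr height_den_unit.
suff bE : b * height_gf h =
    (h == 0)%:R + z * (height_gf (h - 1) + height_gf (h + 1)).
  by rewrite -bE -mulrDl /b subrK mul1r.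
rewrite /height_gf; move: (_^-1) VE => V VE; case: h => [[|n]|n].
- rewrite eqxx /= !expr1 expr0 -[X in X + _]VE; ring.
- have -> : absz (n.+1%:Z - 1) = n by lia.
  have -> : absz (n.+1%:Z + 1) = n.+2 by lia.
  rewrite add0r [absz _]/= -mulrDr mulrCA exprS [b * _]mulrA bq.
  by rewrite -[n.+2]add2n exprD; ring.
have -> : absz (Negz n - 1) = n.+2 by lia.
have -> : absz (Negz n + 1) = n by lia.
rewrite add0r [absz _]/= -mulrDr mulrCA exprS [b * _]mulrA bq.
by rewrite -[n.+2]add2n exprD; ring.
Qed.

(** Both [size_paths_rec] and [height_gfE] express degree [n + 1] by the same combination of lower
    degrees. *)
Lemma size_paths f n h : (n <= f)%N ->
  (size (paths k f n h))%:R = height_gf h n :> rat.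
Proof.
elim: f n h => [|f IHf] n h.
  rewrite leqn0 => /eqP ->; rewrite height_gfE kfib_gf !fcoefD fcoefXM fcoef0M.
  by rewrite mul0r !addr0 fcoef_nat /=; case: eqP.
case: n => [_|n lenf].
  rewrite height_gfE kfib_gf !fcoefD fcoefXM fcoef0M.
  by rewrite mul0r !addr0 fcoef_nat /=; case: eqP.
have fcoefXMS g : (z * g) n.+1 = g n by rewrite fcoefXM.
rewrite size_paths_rec !natrD !IHf // [in RHS]height_gfE.
rewrite kfib_gf [RHS]fcoefD [X in _ = X + _]fcoefD fcoefXMS fcoefD.
rewrite fcoef_nat mul0rn add0r; congr (_ + _).
(* The first term vanishes because [kfib k 0 = 0]. *)
rewrite fcoefM [RHS]big_ord_recl [X in _ = X + _](_ : _ = 0); last exact: mul0r.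
rewrite add0r natr_sum; apply: eq_bigr => l _.
by rewrite natrM IHf ?(leq_trans (leq_subr _ _)).
Qed.

Lemma grand_gfE : grand_gf k = (b - 2%:R * (z * q))^-1.
Proof.
apply/fpsP => n; rewrite [LHS]/= card_grand_path size_paths //.
by rewrite /height_gf expr0 mulr1.
Qed.

(** By uniqueness, the square root with constant term 1 is [w (b - 2 z q)]. *)
Lemma grand_gf_sqrt : grand_gf k =
  w / fps_sqrt ((1 - k.+1%:R * z - z ^+ 2) ^+ 2 - 4%:R * z ^+ 2 * w ^+ 2).
Proof.
rewrite grand_gfE -(@fps_sqrt_uniq _ _ (w * (b - 2%:R * (z * q)))).
- by rewrite invrM ?kfib_den_unit ?height_den_unit // [RHS]mulrCA divrr ?mulr1
    ?kfib_den_unit.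
- exact: rat2_unit.
- rewrite -/(kfib_den k.+1) -kfib_den_level_den.
  have -> : (w * (b - 2%:R * (z * q))) ^+ 2 =
    (w * b) ^+ 2 - 4%:R * z * w ^+ 2 * (b * q - z * q ^+ 2) by ring.
  by rewrite bq; ring.
by rewrite fcoef0M height_den0 kfib_den0.
Qed.

(** * The continued fraction *)

Lemma zq_fix : z * q * (b - z * q) = z ^+ 2.
Proof.
have -> : z * q * (b - z * q) = z * (b * q - z * q ^+ 2) by ring.
by rewrite bq; ring.
Qed.

Definition cfrac_num (i : nat) : fps rat :=
  match i with 0%N => 1 | 1%N => 2%:R * z ^+ 2 | _ => z ^+ 2 end.

Lemma level_denB_unit f : dvdX 1 f -> b - f \is a GRing.unit.
Proof.
by move=> f1; rewrite fps_unitE fcoefB (dvdX_coef f1) // level_den0 subr0.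
Qed.

Lemma dvdX1_zq : dvdX 1 (z * q).
Proof. by apply: dvdX1; rewrite fcoefXM. Qed.

Lemma zq_level_den_unit : b - z * q \is a GRing.unit.
Proof. exact: level_denB_unit dvdX1_zq. Qed.

Lemma zqE : z * q = z ^+ 2 / (b - z * q).
Proof. by rewrite -zq_fix mulrK ?zq_level_den_unit. Qed.

(** From index 2 on all numerators are [z ^+ 2], so a tail iterates [y = z^2 / (b - y)]; of the
    factor [z ^+ 2] gained per level, one [z] is recorded. *)
Lemma cfrac_tail N j :
  dvdX N.+1 (cfrac cfrac_num (fun=> b) N j.+2 - z * q).
Proof.
have z2 : dvdX 1 (z ^+ 2) by apply: dvdX1; rewrite expr2 fcoefXM.
elim: N j => [|N IHN] j /=.
  apply: dvdXD; first by rewrite mulrC; apply: dvdXMl.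
  by rewrite -mulN1r; apply: dvdXMl; apply: dvdX1_zq.
rewrite [X in _ - X]zqE -mulrBr -add1n; apply: dvdXM => //.
have IH := IHN j.+1.
set c := cfrac _ _ _ _ in IH *.
(* The error bound itself shows that [c] has no constant term, so [b - c] is invertible. *)
have c1 : dvdX 1 c.
  rewrite -(subrK (z * q) c); apply: dvdXD; last exact: dvdX1_zq.
  by apply: dvdX1; apply: (dvdX_coef IH).
apply: invrB_dvdX; try exact: level_denB_unit.
  exact: zq_level_den_unit.
have -> : b - c - (b - z * q) = - 1 * (c - z * q) by ring.
exact: dvdXMl.
Qed.

Lemma cfrac_cvg : fps_cvg (fun N => cfrac cfrac_num (fun=> b) N 0) (grand_gf k).
Proof.
have z2 : dvdX 1 (2%:R * z ^+ 2).
  by apply: dvdXMl; apply: dvdX1; rewrite expr2 fcoefXM.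
(* Two levels carry the exceptional numerators [1] and [2 z^2]; below them is a tail of depth
   [N >= n]. *)
move=> n; exists n.+2 => -[|[|N]] //; rewrite !ltnS => lenN.
apply: (@dvdX_eq_coef _ N.+1) => //; rewrite grand_gfE /= mul1r.
have := cfrac_tail N 0; set c := cfrac _ _ _ _ => cN.
have c1 : dvdX 1 c.
  rewrite -(subrK (z * q) c); apply: dvdXD; last exact: dvdX1_zq.
  by apply: dvdX1; apply: (dvdX_coef cN).
have uc := level_denB_unit c1.
apply: invrB_dvdX.
- by apply: level_denB_unit; rewrite mulrC; apply: dvdXMl.
- exact: height_den_unit.
rewrite zqE.
have -> : b - 2%:R * z ^+ 2 / (b - c) - (b - 2%:R * (z ^+ 2 / (b - z * q))) =
  (- 2%:R * z ^+ 2) * ((b - c)^-1 - (b - z * q)^-1).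
  by move: (_^-1) (_^-1) => ? ?; ring.
apply: dvdXMl; apply: invrB_dvdX; rewrite ?zq_level_den_unit //.
have -> : b - c - (b - z * q) = - 1 * (c - z * q) by ring.
exact: dvdXMl.
Qed.

(** * The coefficient formula *)

Lemma grand_gf_coef t : (1 <= t)%N ->
  grand_gf k t = conv_kfib k.+1 1 t
    + \sum_(1 <= n < t.+1) \sum_(0 <= m < t.+1)
        \sum_(0 <= l < t.+1 - (2 * n + 2 * m))
          2%:R ^+ n * (n%:R / (n + 2 * m)%:R)
          * ('C(n + 2 * m, m))%:R * ('C(l + 2 * n + 2 * m, l))%:R
          * conv_kfib k l (t - 2 * n - 2 * m - l + 1)%N.
Proof.
move=> t_gt0; have ub := level_den_unit.
set g := z * q / b; set x := (z / b) ^+ 2.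
have gE : g = x + g ^+ 2.
  have -> : x = z * q * (b - z * q) / b ^+ 2 by rewrite zq_fix /x expr_div_n.
  rewrite /g expr_div_n -mulrDl mulrBr expr2 subrK expr2 invrM // mulrA mulrK //.
have g2 : dvdX 2 g.
  rewrite /g mulrC; apply: dvdXMl; apply: (@dvdXM _ 1 1); last exact: dvdX1.
  by exists 1; rewrite mulr1.
have x2 : dvdX 2 x by exists (b ^- 2); rewrite /x expr_div_n.
have g1 : dvdX 1 (2%:R * g).
  by apply: dvdXMl; apply: dvdX1; apply: (dvdX_coef g2).
have TE : grand_gf k = b^-1 * (1 - 2%:R * g) ^- 1.
  rewrite grand_gfE expr1 -invrM //; last first.
    by rewrite fps_unitE fcoefB (dvdX_coef g1) // subr0 unitr1.
  by congr (_^-1); rewrite mulrBl mul1r -mulrA divrK.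
have Tcoef : grand_gf k t = \sum_(n < t.+1) 2%:R ^+ n * (b^-1 * g ^+ n) t.
  rewrite TE; have := dvdXMl b^-1 (neg_binomial_expansion 1 t.+1 g1).
  rewrite mulrBr => /dvdX_eq_coef -> //; rewrite mulr_sumr fcoef_sum.
  apply: eq_bigr => n _; rewrite addn1 subn1 binn mul1r exprMn mulrCA.
  by rewrite -(natrX (fps rat)) fcoef_natM natrX.
(* As [b^-1 x^s = z^(2s) b^-(2s+1)], the binomials are ['C(l + 2 s, l)]; the truncated bound empties
   the sum when [2 s > t]. *)
have xcoef s : (b^-1 * x ^+ s) t =
    \sum_(l < t.+1 - 2 * s) ('C(l + 2 * s, l))%:R * (w ^- l) (t - 2 * s - l)%N.
  have -> : b^-1 * x ^+ s = z ^+ (2 * s) * b ^- (2 * s).+1.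
    by rewrite /x -exprM exprMn mulrCA exprVn exprSr invrM ?unitrX.
  rewrite fcoefXnM; case: leqP => [les|gts]; last first.
    by rewrite (eqP gts) big_ord0.
  rewrite level_den_pow_coef subSn //.
  by apply: eq_bigr => l _; rewrite addnS subn1.
(* The term [n = 0] is [b^-1], giving the convolved number for [k + 1]. *)
rewrite Tcoef big_ord_recl !expr0 mul1r mulr1; congr (_ + _).
  by case: t t_gt0 {Tcoef xcoef} => // t _; rewrite level_den_inv_coef.
rewrite big_add1 big_mkord; apply: eq_bigr => n _; rewrite lift0.
(* With [t + 1] terms the remainder has order at least [2 (n + t + 2) > t], so the truncation is
   exact in degree [t]. *)
have := dvdXMl b^-1 (ballot_expansion t.+1 n.+1 x2 g2 gE).
rewrite mulrBr => /dvdX_eq_coef ->; last by lia.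
rewrite [b^-1 * _]mulr_sumr fcoef_sum mulr_sumr big_mkord; apply: eq_bigr => m _.
rewrite mulrCA fcoef_natM xcoef mulnDr big_mkord 2!mulr_sumr.
have nm : ((n.+1 + 2 * m)%:R : rat) != 0 by rewrite pnatr_eq0.
have -> : (ballot m n.+1)%:R =
    n.+1%:R / (n.+1 + 2 * m)%:R * 'C(n.+1 + 2 * m, m)%:R :> rat.
  by apply: (mulIf nm); rewrite -natrM ballotE natrM mulrAC divfK.
by apply: eq_bigr => l _; rewrite /conv_kfib addn1 -!subnDA !addnA !mulrA.
Qed.

End Main.

Unset Implicit Arguments.

Theorem theorem3p7 (k : nat) (k_gt0 : (0 < k)%N) :
  let z := fpsX rat in
  let w := 1 - k%:R * z - z ^+ 2 in
  let T := grand_gf k in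
  [/\ T = w / fps_sqrt ((1 - k.+1%:R * z - z ^+ 2) ^+ 2
                        - 4%:R * z ^+ 2 * w ^+ 2),
      fps_cvg
        (fun N => cfrac
           (fun i => match i with 0%N => 1 | 1%N => 2%:R * z ^+ 2 | _ => z ^+ 2 end)
           (fun _ => 1 - z / w) N 0)
        T &
      forall t : nat, (1 <= t)%N ->
        T t = conv_kfib k.+1 1 t
          + \sum_(1 <= n < t.+1) \sum_(0 <= m < t.+1)
              \sum_(0 <= l < t.+1 - (2 * n + 2 * m))
                2%:R ^+ n * (n%:R / (n + 2 * m)%:R)
                * ('C(n + 2 * m, m))%:R * ('C(l + 2 * n + 2 * m, l))%:R
                * conv_kfib k l (t - 2 * n - 2 * m - l + 1)%N].
Proof.
have [q [q0 bq]] := kernel_root (level_den0 k).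
split.
- exact: grand_gf_sqrt bq.
- exact: cfrac_cvg bq.
- exact: grand_gf_coef bq.
Qed.
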